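(* Let $(X,d)$ be a metric space and let $f:X\to\mathbb{R}$ be a function. Then there is a rich family $\mathcal{R}$ of closed separable subsets of $X$ such that for every $Y\in\mathcal{R}$ and every $x\in Y$ we have $$\mathrm{Lip}\, f(x)=\mathrm{Lip}\,(f|_Y)(x).$$
   Context: A family $\mathcal{R}$ of closed separable subsets (subspaces) of $X$ is called rich if: (i) (cofinality) for every separable subspace $Y_0$ of $X$ there is $Y\in\mathcal{R}$ with $Y_0\subset Y$; (ii) ($\sigma$-closedness) if $(Y_i)_{i\ge1}$ is an increasing sequence of elements of $\mathcal{R}$, then $\overline{\bigcup_{i\ge1}Y_i}\in\mathcal{R}$. $B(x,r)$ denotes the open ball with center $x$ and radius $r$. For a function $f:X\to\mathbb{R}$ on a metric space $(X,d)$, the Lipschitz modulus of $f$ at $x\in X$ is $$\mathrm{Lip}\, f(x):=\inf\Big\{c>0:\ \exists r>0:\ \sup\Big\{\tfrac{|f(u_1)-f(u_2)|}{d(u_1,u_2)}: u_1\neq u_2,\ u_1,u_2\in B(x,r)\Big\}\le c\Big\},$$ with the convention $\inf\emptyset=+\infty$ (and the inequality $\sup\emptyset\le c$ is regarded as true). $f|_Y$ is the restriction of $f$ to $Y$, and $\mathrm{Lip}\,(f|_Y)(x)$ is its Lipschitz modulus at $x$ in the metric space $(Y,d)$, i.e. with $B(x,r)$ replaced by $Y\cap B(x,r)$. *)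

(* Defs.v *)
From HB Require Import structures.
From mathcomp Require Import all_boot all_order all_algebra.
From mathcomp Require Import all_classical all_reals all_analysis.

Set Implicit Arguments.
Unset Strict Implicit.
Unset Printing Implicit Defensive.

Import Order.TTheory GRing.Theory Num.Theory.

Local Open Scope classical_set_scope.
Local Open Scope ring_scope.

(* The library puts only the induced pseudometric structure on [set_type A];
   the instance below makes a subset of a metric space a metric space, with the
   restricted distance. *)
Section subset_metric.
Context {R : realType} {X : metricType R} (A : set X).

Let sub_mdist (x y : A) : R := mdist (set_val x) (set_val y).

Let sub_mdist_ge0 x y : 0 <= sub_mdist x y.
Proof. exact: mdist_ge0. Qed.

Let sub_mdist_positivity x y : sub_mdist x y = 0 -> x = y.
Proof. by move=> /mdist_positivity; rewrite set_valE => /val_inj. Qed.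

Let sub_ballE (x : A) d : ball x d = [set y | sub_mdist x y < d].
Proof.
transitivity (@set_val X A @^-1` ball (set_val x) d); first by [].
by rewrite ballEmdist.
Qed.

HB.instance Definition _ := @PseudoMetric_isMetric.Build R (set_type A)
  sub_mdist sub_mdist_ge0 sub_mdist_positivity sub_ballE.

End subset_metric.

Definition separable (T : topologicalType) : Prop :=
  exists2 D : set T, countable D & dense D.

Section rich.
Context (T : topologicalType).

Definition separable_set (A : set T) : Prop := separable (set_type A).

Definition cofinal_family (F : set (set T)) : Prop :=
  forall A : set T, separable_set A -> exists2 Y, F Y & A `<=` Y.

Definition sigma_closed_family (F : set (set T)) : Prop :=
  forall Y : (set T)^nat, (forall i, F (Y i)) ->
    (forall i, Y i `<=` Y i.+1) -> F (closure (\bigcup_i Y i)).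

Definition rich_family (F : set (set T)) : Prop :=
  [/\ forall Y, F Y -> closed Y /\ separable_set Y,
      cofinal_family F & sigma_closed_family F].

End rich.

Section lipschitz_modulus.
Context {R : realType} {X : metricType R}.

Definition difference_quotients (f : X -> R) (B : set X) : set (\bar R) :=
  [set (`|f u.1 - f u.2| / mdist u.1 u.2)%:E
     | u in [set u : X * X | [/\ u.1 <> u.2, B u.1 & B u.2]]].

(* [ereal_sup set0 = -oo] and [ereal_inf set0 = +oo], so the conventions on
   empty sets hold: an isolated point has modulus 0, and the modulus is [+oo]
   where [f] is not locally Lipschitz. *)
Definition lipschitz_modulus (f : X -> R) (x : X) : \bar R :=
  ereal_inf [set c%:E | c in [set c : R | 0 < c /\
    exists2 r : R, 0 < r &
      (ereal_sup (difference_quotients f (ball x r)) <= c%:E)%E]].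

End lipschitz_modulus.

(* Main.v *)
Require Import Defs.
From mathcomp Require Import all_boot all_order all_algebra.
From mathcomp Require Import all_classical all_reals all_analysis.
From mathcomp Require Import lra.

(** The inequality [Lip (f|_Y) x <= Lip f x] only forgets pairs of points, and
    the converse could fail only because [Y] misses the pairs that witness the
    steepness of [f] near [x].  Call a pair in the ball [ball y r] steep when
    its difference quotient exceeds [c].  The family [F] consists of the closed
    separable sets [Y] that contain a steep pair whenever the whole space has
    one, for centers [y] in [Y].  In such a [Y] the same bounds [c] are valid
    on [ball x r] and on its trace, so the two moduli are infima of the same
    set of numbers.

    Richness rests on [steep_pair_of_closure]: steepness is an open condition,
    hence it is enough to know the property for rational [r] and [c] and for
    centers in a dense subset.  Closures of increasing unions are then covered
    by the property of the members.  For cofinality, fix one steep pair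
    for every center and every rational [r] and [c]; a countable dense subset
    of the given set stays countable when closed under these countably many
    choice functions, and its closure is the required member of [F]. *)

Import Order.TTheory GRing.Theory Num.Theory.

Local Open Scope classical_set_scope.
Local Open Scope ring_scope.

(** Dense subsets of different subspaces live in different types; as sets
    of the ambient space they can be united, enlarged and compared. *)
Lemma separable_setP (T : topologicalType) (A : set T) :
  separable_set A <->
  exists E : set T, [/\ countable E, E `<=` A & A `<=` closure E].
Proof.
split=> [[D cD dD]|[E [cE EA AE]]].
  exists (set_val @` D); split.
  - exact: sub_countable (card_image_le set_val D) cD.
  - by move=> _ [x _ <-]; exact: set_valP.
  - move=> x Ax B; rewrite nbhsE => -[U [oU Ux] UB].
    have [||y [Uy Dy]] := dD (set_val @^-1` U).
    + by exists (SigSub (mem_set Ax)).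
    + by exists U.
    + by exists (set_val y); split; [exists y|exact: UB].
exists (set_val @^-1` E).
  rewrite -(eq_countable (inj_card_eq (f := set_val) _)); last first.
    by move=> x y _ _; rewrite set_valE => /val_inj.
  by apply: sub_countable cE; apply: subset_card_le => _ [x Ex <-].
move=> O [x Ox] [U oU UO].
have [|y [Ey Uy]] := AE _ (set_valP x) U.
  by apply: open_nbhs_nbhs; split => //; move: Ox; rewrite -UO.
exists (SigSub (mem_set (EA _ Ey))); split => //.
by rewrite -UO.
Qed.

(** Every element reached from [D] is described by a starting point and a word
    over [I], and there are only countably many words. *)
Lemma countable_orbit (T : Type) (I : countType) (g : T -> I -> T)
    (D : set T) :
  countable D ->
  exists E : set T,
    [/\ countable E, D `<=` E & forall x i, E x -> E (g x i)].
Proof.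
move=> cD; exists [set foldl g p.1 p.2 | p in D `*` [set: seq I]]; split.
- apply: sub_countable (card_image_le _ _) _.
  by apply: countableX => //; exact: countableP.
- by move=> x Dx; exists (x, [::]).
- move=> _ i [[x w] [Dx _] <-]; exists (x, rcons w i) => //=.
  by rewrite foldl_rcons.
Qed.

Section steep_pairs.
Context {R : realType} {X : metricType R} (f : X -> R).
Implicit Types (x y : X) (r c : R) (u : X * X) (E Y : set X).

Definition steep_pair y r c u : Prop :=
  [/\ u.1 <> u.2, ball y r u.1, ball y r u.2 &
      c < `|f u.1 - f u.2| / mdist u.1 u.2].

Lemma difference_quotients_leP y r c :
  (ereal_sup (difference_quotients f (ball y r)) <= c%:E)%E <->
  forall u, ~ steep_pair y r c u.
Proof.
split=> [/ereal_supP h u [u12 yu1 yu2]|h].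
  by rewrite ltNge -lee_fin h//; exists u.
apply/ereal_supP => _ [u [u12 yu1 yu2] <-].
by rewrite lee_fin leNgt; apply/negP => cu; exact: (h u).
Qed.

(** The parameters are rational so that [reflecting] asks for closure under
    countably many operations; [steep_pair_of_closure] recovers the real ones. *)
Definition reflecting E : Prop :=
  forall y (q s : rat), E y -> (exists u, steep_pair y (ratr q) (ratr s) u) ->
  exists u, [/\ E u.1, E u.2 & steep_pair y (ratr q) (ratr s) u].

(** A steep pair in [ball y r] lies in a slightly smaller ball and exceeds [c]
    by a margin, so it is still steep for a nearby center in [E], a rational
    radius below [r] and a rational slope above [c]. *)
Lemma steep_pair_of_closure E y r c : reflecting E -> closure E y ->
  (exists u, steep_pair y r c u) ->
  exists u, [/\ E u.1, E u.2 & steep_pair y r c u].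
Proof.
move=> rE Ey [u [u12]]; rewrite ballEmdist /= => yu1 yu2 cu.
have [s /[!in_itv]/= /andP[cs su]] := rat_in_itvoo cu.
pose m := Num.max (mdist y u.1) (mdist y u.2).
have [m1 m2] : mdist y u.1 <= m /\ mdist y u.2 <= m.
  by rewrite /m !le_max !lexx orbT.
have mr : m < r by rewrite /m gt_max yu1 yu2.
(* Moving the center by less than [e] changes distances by less than [e]: a
   radius above [m + e] keeps [u] in the ball, and one below [m + 2 * e]
   keeps the new ball inside [ball y r]. *)
pose e := (r - m) / 3.
have e0 : 0 < e by rewrite /e; lra.
have [|q /[!in_itv]/= /andP[mq qr]] := @rat_in_itvoo R (m + e) (m + 2 * e).
  lra.
have [z [Ez]] := Ey _ (nbhsx_ballx y e e0); rewrite ballEmdist /= => yz.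
have near v : mdist y v <= m -> ball z (ratr q) v.
  rewrite ballEmdist /= => yv; have := metric_triangle z y v.
  rewrite (metric_sym z y); lra.
have back v : ball z (ratr q) v -> ball y r v.
  rewrite !ballEmdist /= => zv; have := metric_triangle y z v.
  rewrite /e in yz qr *; lra.
have [|v [Ev1 Ev2 [v12 zv1 zv2 sv]]] := rE z q s Ez.
  by exists u; split => //; exact: near.
exists v; split => //; split => //; [exact: back|exact: back|].
exact: lt_trans sv.
Qed.

Lemma reflecting_closure E : reflecting E -> reflecting (closure E).
Proof.
move=> rE y q s Ey /(steep_pair_of_closure _ _ _ _ rE Ey)[u [Eu1 Eu2 su]].
by exists u; split => //; exact: subset_closure.
Qed.

Lemma reflecting_bigcup (Y : (set X)^nat) :
  (forall i, reflecting (Y i)) -> reflecting (\bigcup_i Y i).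
Proof.
move=> rY y q s [i _ Yiy] /(rY i _ _ _ Yiy)[u [Yu1 Yu2 su]].
by exists u; split => //; exists i.
Qed.

(** The two components of the chosen steep pairs, indexed by the rational
    parameters and a boolean, are the operations under which to close. *)
Lemma reflecting_countable_hull D : countable D ->
  exists E, [/\ countable E, D `<=` E & reflecting E].
Proof.
move=> cD.
have [p pP] : {p : X -> rat -> rat -> X * X & forall y q s,
    (exists u, steep_pair y (ratr q) (ratr s) u) ->
    steep_pair y (ratr q) (ratr s) (p y q s)}.
  exists (fun y q s =>
    if pselect (exists u, steep_pair y (ratr q) (ratr s) u) is left h
    then projT1 (cid h) else (y, y)) => y q s h.
  by case: pselect => // h'; exact: projT2 (cid h').
pose g x (i : rat * rat * bool) :=
  if i.2 then (p x i.1.1 i.1.2).1 else (p x i.1.1 i.1.2).2.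
have [E [cE DE Eg]] := countable_orbit _ _ g _ cD.
exists E; split => // y q s Ey h; exists (p y q s); split; last exact: pP.
- exact: (Eg y (q, s, true)).
- exact: (Eg y (q, s, false)).
Qed.

Definition reflecting_family : set (set X) :=
  [set Y | [/\ closed Y, separable_set Y & reflecting Y]].

Lemma rich_reflecting_family : rich_family reflecting_family.
Proof.
split.
- by move=> Y [].
- move=> A /separable_setP[D [cD _ AD]].
  have [E [cE DE rE]] := reflecting_countable_hull _ cD.
  exists (closure E); last by apply: subset_trans AD _; exact: closure_subset.
  split; [exact: closed_closure| |exact: reflecting_closure].
  by apply/separable_setP; exists E; split => //; exact: subset_closure.
- move=> Y FY _; split; first exact: closed_closure.
  + have /choice[E EP] i : exists E, [/\ countable E, E `<=` Y i &
        Y i `<=` closure E] by have [_ /separable_setP] := FY i.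
    apply/separable_setP; exists (\bigcup_i E i); split.
    * by apply: bigcup_countable => // i _; have [] := EP i.
    * move=> x [i _ Eix]; apply: subset_closure; exists i => //.
      by have [_ + _] := EP i; apply.
    * have /closure_id -> := @closed_closure _ (\bigcup_i E i).
      apply: closure_subset => x [i _ Yix].
      have [_ _ /(_ _ Yix)] := EP i.
      by apply: closure_subset; exact: bigcup_sup.
  + apply/reflecting_closure/reflecting_bigcup => i.
    by have [] := FY i.
Qed.

End steep_pairs.

(** Balls and distances of the subspace [Y] are those of [X], so the steep
    pairs of the restriction are the steep pairs of [f] with both points
    in [Y]; one exists as soon as [f] has a steep pair around [x], for the same
    radius and the same bound. *)
Lemma difference_quotients_restrict_le (R : realType) (X : metricType R)
    (f : X -> R) (Y : set X) (x : Y) (r c : R) : reflecting_family f Y ->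
  (ereal_sup (difference_quotients f (ball (set_val x) r)) <= c%:E)%E <->
  (ereal_sup (difference_quotients (sigL Y f) (ball x r)) <= c%:E)%E.
Proof.
move=> [cY _ rY]; rewrite !difference_quotients_leP.
split=> h u su.
  have [u12 xu1 xu2 cu] := su.
  apply: (h (set_val u.1, set_val u.2)); split => //=.
  by rewrite set_valE => /val_inj.
have [|v [Yv1 Yv2 [v12 xv1 xv2 cv]]] :=
    steep_pair_of_closure f Y (set_val x) r c rY (subset_closure (set_valP x)).
  by exists u.
apply: (h (SigSub (mem_set Yv1), SigSub (mem_set Yv2))); split => //=.
by move=> /(congr1 set_val).
Qed.

(* [sigL Y f] is the restriction of [f] to the subtype [Y]. *)
Theorem theorem3p3 (R : realType) (X : metricType R) (f : X -> R) :
  exists F : set (set X), rich_family F /\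
    forall Y : set X, F Y -> forall x : Y,
      lipschitz_modulus f (set_val x) = lipschitz_modulus (sigL Y f) x.
Proof.
exists (reflecting_family f); split; first exact: rich_reflecting_family.
move=> Y FY x; congr ereal_inf; congr image.
by apply/seteqP; split=> c [c0 [r r0 h]]; split=> //; exists r => //;
  apply/(difference_quotients_restrict_le R X f Y x r c FY).
Qed.
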